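(* Let $S_n$ denote a random variable with the symmetric binomial distribution $B(n,\tfrac12)$, i.e. $P(S_n=k)=\binom{n}{k}2^{-n}$ for $k\in\{0,\dots,n\}$. Then for every real number $x>0$ and every integer $n\geq \max(4x^2,2)$, $$\left|\,P\Big(\big|S_n-\tfrac{n}{2}\big|<x\,\tfrac{\sqrt n}{2}\Big)-\int_{-x}^{x}e^{-s^2/2}\,\frac{ds}{\sqrt{2\pi}}\,\right|\;\leq\; e^{\frac{4x^3+8}{\sqrt n}}-1 .$$
   Context: Equivalently, $S_n=X_1+\cdots+X_n$, where $X_1,\dots,X_n$ are independent Bernoulli random variables with $P(X_i=0)=P(X_i=1)=\tfrac12$. *)

(* Defs.v *)
From HB Require Import structures.
From mathcomp Require Import all_boot all_order all_algebra.
From mathcomp Require Import all_classical all_reals all_analysis.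

Set Implicit Arguments.
Unset Strict Implicit.
Unset Printing Implicit Defensive.

Import Order.TTheory GRing.Theory Num.Theory.
Import numFieldNormedType.Exports.

Local Open Scope classical_set_scope.
Local Open Scope ring_scope.

(* The masses sum to 1, so they determine the law of [S]: no condition on the
   values of [S] outside {0, ..., n} is needed. *)
Definition symmetric_binomial (R : realType) (d : measure_display)
    (T : measurableType d) (P : probability T R) (n : nat)
    (S : {RV P >-> R}) : Prop :=
  forall k : nat, (k <= n)%N ->
    P [set w | S w = k%:R] = ('C(n, k)%:R * 2 ^- n)%:E.

(* Main.v *)
Require Import Defs.
From HB Require Import structures.
From mathcomp Require Import all_boot all_order all_algebra.
From mathcomp Require Import all_classical all_reals all_analysis.
From mathcomp Require Import ring lra zify.

Set Implicit Arguments.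
Unset Strict Implicit.
Unset Printing Implicit Defensive.

Import Order.TTheory GRing.Theory Num.Theory.
Import numFieldNormedType.Exports.

Local Open Scope classical_set_scope.
Local Open Scope ring_scope.

(** The proof is a local limit theorem summed over a window.

    Write [s] for the square root of [n], [binom_mass n k] for the mass
    ['C(n, k) / 2 ^ n], and [Y = (2 k - n) / s] for the standardised position
    of [k], so that the event is [`|Y| < x] and neighbouring positions are
    [2 / s] apart.  The heart is [binom_mass_local_limit]: for [`|Y| <= x] and
    every [y] within [1 / s] of [Y], the mass at [k] equals [2 / s] times the
    standard normal density at [y], up to a factor [expR E] in either
    direction, where [E = (4 x ^ 3 + 4) / s].  It has two ingredients.

    - Away from the mode.  With [t = (2 k + 1 - n) / (n + 1)], consecutive
      masses have ratio [(1 - t) / (1 + t)], which is [expR (- 2 t)] up to a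
      factor [expR (4 t ^ 2)] ([binom_mass_step]).  Since [2 t] is an exact
      increment of [2 (k - n / 2) ^ 2 / (n + 1)], the main terms telescope to
      the Gaussian exponent, while at most [x s / 2] steps with
      [t <= x / s] contribute the error [2 x ^ 3 / s] ([binom_mass_iter]).

    - At the mode.  Wallis integrals of powers of the cosine give
      [n b ^ 2 <= 2 / pi <= (n + 2) b ^ 2] for the central mass [b]
      ([binom_mass_mode_le], [binom_mass_mode_ge]); this is where the
      normalisation by the square root of [2 pi] comes from.

    As the estimate is uniform over the cell of radius [1 / s] around [Y], it
    compares the mass at [k] with the normal probability of that cell
    ([binom_mass_cell]).  The cells of consecutive integers are adjacent, so
    the normal probabilities add up to that of one interval, whose endpoints
    are within [1 / s] of [- x] and [x] ([integer_window]).  The density is at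
    most [1 / 2], hence the endpoints cost at most [1 / s] altogether, and
    [expR_approx] merges the relative error [E] and the absolute error
    [1 / s]: the result holds because [E + 1 / s <= (4 x ^ 3 + 8) / s]. *)

(** * The standard normal distribution *)

Lemma Rintegral_cst_itv {R : realType} (a b c : R) : a <= b ->
  \int[lebesgue_measure]_(s in `[a, b]) c = c * (b - a).
Proof.
move=> ab; rewrite (Rintegral_cst lebesgue_measure (measurable_itv `[a, b])).
congr (_ * _); transitivity (fine (lebesgue_measure `[a, b])) => //.
rewrite lebesgue_measure_itv/= lte_fin.
by case: ltgtP ab => // -> _; rewrite subrr.
Qed.

Section GaussianDistribution.
Context {R : realType}.
Notation mu := (@lebesgue_measure R).

Definition std_normal_pdf (s : R) : R :=
  expR (- (s ^+ 2) / 2) / Num.sqrt (2 * pi).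

Lemma std_normal_pdfE : std_normal_pdf = normal_pdf 0 1.
Proof.
rewrite normal_pdfE ?oner_eq0//; apply/funext => s.
rewrite /std_normal_pdf /normal_peak /normal_fun subr0 expr1n mul1r mulrC.
by rewrite mulr_natl.
Qed.

Lemma std_normal_pdf_integrable (i : interval R) :
  mu.-integrable [set` i] (EFin \o std_normal_pdf).
Proof.
rewrite std_normal_pdfE.
exact: (integrableS measurableT _ (@subsetT _ _) (integrable_normal_pdf 0 1)).
Qed.

Definition std_normal_cdf (b : R) : R :=
  \int[mu]_(s in `]-oo, b]) std_normal_pdf s.

Lemma std_normal_cdfB (a b : R) : a <= b ->
  std_normal_cdf b - std_normal_cdf a = \int[mu]_(s in `[a, b]) std_normal_pdf s.
Proof.
move=> ab; rewrite /std_normal_cdf Rintegral_itvB ?bnd_simp//.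
  by rewrite Rintegral_itv_obnd_cbnd//; exact: std_normal_pdf_integrable.
exact: std_normal_pdf_integrable.
Qed.

Let cst_itv_integrable (a b c : R) : mu.-integrable `[a, b] (EFin \o cst c).
Proof.
apply: continuous_compact_integrable; first exact: segment_compact.
by apply: continuous_subspaceT => t; exact: cvg_cst.
Qed.

Lemma std_normal_cdfB_ge (a b c : R) : a <= b ->
  (forall s, a <= s <= b -> c <= std_normal_pdf s) ->
  c * (b - a) <= std_normal_cdf b - std_normal_cdf a.
Proof.
move=> ab cf; rewrite std_normal_cdfB//.
have -> : c * (b - a) = \int[mu]_(s in `[a, b]) c.
  by rewrite Rintegral_cst_itv.
apply: le_Rintegral => //.
- exact: cst_itv_integrable.
- exact: std_normal_pdf_integrable.
Qed.

Lemma std_normal_cdfB_le (a b c : R) : a <= b ->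
  (forall s, a <= s <= b -> std_normal_pdf s <= c) ->
  std_normal_cdf b - std_normal_cdf a <= c * (b - a).
Proof.
move=> ab cf; rewrite std_normal_cdfB//.
have -> : c * (b - a) = \int[mu]_(s in `[a, b]) c.
  by rewrite Rintegral_cst_itv.
apply: le_Rintegral => //.
- exact: std_normal_pdf_integrable.
- exact: cst_itv_integrable.
Qed.

(** The interval has mass at most 1 under the library's normal probability,
    whose normalisation is the Gaussian integral. *)
Lemma std_normal_cdfB_le1 (a b : R) : a <= b ->
  std_normal_cdf b - std_normal_cdf a <= 1.
Proof.
move=> ab; rewrite std_normal_cdfB// std_normal_pdfE.
have := probability_le1 (normal_prob (0 : R) 1 : probability _ R)
  (measurable_itv `[a, b]).
rewrite -lee_fin fineK//.
by apply: integrable_fin_num => //; rewrite -std_normal_pdfE;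
  exact: std_normal_pdf_integrable.
Qed.

Lemma std_normal_pdf_le_half (s : R) : std_normal_pdf s <= 2^-1.
Proof.
rewrite /std_normal_pdf; have pi2 := @pi_ge2 R.
have s2 : 2 <= Num.sqrt (2 * pi) :> R.
  by rewrite -ler_sqr ?nnegrE ?sqrtr_ge0// sqr_sqrtr; lra.
rewrite ler_pdivrMr; last by lra.
apply: (@le_trans _ _ 1); last by lra.
by rewrite -[leRHS]expR0 ler_expR; have := sqr_ge0 s; lra.
Qed.

Lemma std_normal_cdf_lipschitz (u v : R) :
  `|std_normal_cdf u - std_normal_cdf v| <= `|u - v| / 2.
Proof.
wlog vu : u v / v <= u.
  by move=> h; have [/h//|/ltW/h] := leP v u; rewrite distrC (distrC v).
have h0 : 0 * (u - v) <= std_normal_cdf u - std_normal_cdf v.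
  apply: std_normal_cdfB_ge => // s _.
  by rewrite /std_normal_pdf divr_ge0 ?expR_ge0 ?sqrtr_ge0.
have h1 := std_normal_cdfB_le vu (fun s _ => std_normal_pdf_le_half s).
by rewrite !ger0_norm; lra.
Qed.

End GaussianDistribution.

(** * Wallis integrals *)

Section Wallis.
Context {R : realType}.
Notation mu := (@lebesgue_measure R).

Definition wallis (n : nat) : R := \int[mu]_(t in `[0, pi / 2]) cos t ^+ n.

Let pihalf_gt0 : 0 < pi / 2 :> R.
Proof. by have := @pi_gt0 R; lra. Qed.

Let cosX_continuous n : continuous (fun t : R => cos t ^+ n).
Proof.
move=> t; rewrite -[X in continuous_at _ X]/((GRing.exp (R:=R))^~ n \o cos).
apply: continuous_comp; first exact: continuous_cos.
exact: exprn_continuous.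
Qed.

Let cosX_integrable n :
  mu.-integrable `[0, pi / 2] (EFin \o (fun t => cos t ^+ n)).
Proof.
apply: continuous_compact_integrable; first exact: segment_compact.
exact/continuous_subspaceT/cosX_continuous.
Qed.

Lemma wallis0 : wallis 0 = pi / 2.
Proof.
rewrite /wallis (_ : (fun t : R => _) = cst 1); last first.
  by apply/funext => t; rewrite expr0.
by rewrite Rintegral_cst_itv ?ltW// subr0 mul1r.
Qed.

Let FTC2 (F f : R -> R) : continuous f -> (forall t : R, is_derive t 1 F (f t)) ->
  \int[mu]_(t in `[0, pi / 2]) f t = F (pi / 2) - F 0.
Proof.
move=> cf dF; rewrite /Rintegral (@continuous_FTC2 _ f F)//.
- exact/continuous_subspaceT.
- have cF t : F x @[x --> t] --> F t.
    by apply/differentiable_continuous/derivable1_diffP.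
  split; first by move=> t _.
  - exact/cvg_at_right_filter.
  - exact/cvg_at_left_filter.
- by move=> t _; rewrite derive1E; apply: derive_val.
Qed.

Lemma wallis1 : wallis 1 = 1.
Proof.
rewrite /wallis (@FTC2 sin (fun t => cos t ^+ 1)).
- by rewrite sin_pihalf sin0 subr0.
- exact: cosX_continuous.
Qed.

(** Instead of integrating by parts: the difference of the two sides is the
    integral of the derivative of [sin t * cos t ^+ n.+1], which vanishes at both
    endpoints. *)
Lemma wallisSS n : n.+2%:R * wallis n.+2 = n.+1%:R * wallis n.
Proof.
pose f t := n.+2%:R * cos t ^+ n.+2 - n.+1%:R * cos t ^+ n : R.
have cf : continuous f.
  move=> t; apply: cvgB; apply: cvgM; try exact: cvg_cst; exact: cosX_continuous.
have dF (t : R) : is_derive t 1 (fun t : R => sin t * cos t ^+ n.+1) (f t).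
  have -> : (fun t : R => sin t * cos t ^+ n.+1) = sin * cos ^+ n.+1.
    by apply/funext => u; rewrite mulrfctE exprfctE.
  apply: is_derive_eq; rewrite exprfctE /GRing.scale/= /f.
  have := sin2cos2 t; rewrite -(natr1 n.+1) !exprS expr0 => s2.
  have -> : sin t * (n.+1%:R * cos t ^+ n * - sin t) =
            - n.+1%:R * cos t ^+ n * (sin t * (sin t * 1)) by ring.
  by rewrite s2; ring.
have := FTC2 cf dF.
rewrite cos_pihalf sin0 expr0n/= !(mulr0, mul0r) subrr.
have intZ (c : R) k :
    mu.-integrable `[0, pi / 2] (EFin \o (fun t => c * cos t ^+ k)).
  apply: continuous_compact_integrable; first exact: segment_compact.
  apply: continuous_subspaceT => t.
  by apply: cvgM; [exact: cvg_cst|exact: cosX_continuous].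
by rewrite /f RintegralB// !RintegralZl// => /eqP; rewrite subr_eq0 => /eqP.
Qed.

Lemma wallis_ge0 n : 0 <= wallis n.
Proof.
apply: Rintegral_ge0 => t /=; rewrite in_itv/= => /andP[t0 t1].
by apply/exprn_ge0/cos_ge0_pihalf; rewrite t1 andbT; have := pihalf_gt0; lra.
Qed.

Lemma wallis_decr n : wallis n.+1 <= wallis n.
Proof.
apply: le_Rintegral => // t /=; rewrite in_itv/= => /andP[t0 t1].
have c0 : 0 <= cos t.
  by apply: cos_ge0_pihalf; rewrite t1 andbT; have := pihalf_gt0; lra.
by rewrite exprS ler_piMl ?exprn_ge0// cos_le1.
Qed.

(** The recurrence makes this quantity constant in [n]; monotonicity then traps
    the square of each integral, with no limit to be taken. *)
Lemma wallis_mul n : n.+1%:R * (wallis n * wallis n.+1) = pi / 2.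
Proof.
elim: n => [|n IH]; first by rewrite wallis0 wallis1; lra.
by rewrite mulrCA wallisSS -IH; lra.
Qed.

Lemma wallis_sqr_ge n : pi / 2 <= n.+1%:R * wallis n ^+ 2.
Proof.
by rewrite -(wallis_mul n) ler_wpM2l// expr2 ler_wpM2l ?wallis_ge0// wallis_decr.
Qed.

Lemma wallis_sqr_le n : n%:R * wallis n ^+ 2 <= pi / 2.
Proof.
case: n => [|n]; first by rewrite mul0r ltW.
by rewrite -(wallis_mul n) ler_wpM2l// expr2 ler_wpM2r ?wallis_ge0// wallis_decr.
Qed.

End Wallis.

(** * Binomial masses *)

Section BinomialMass.
Context {R : realType}.

Definition binom_mass (n k : nat) : R := 'C(n, k)%:R * 2 ^- n.

Lemma binom_mass_gt0 n k : (k <= n)%N -> 0 < binom_mass n k.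
Proof.
by move=> kn; rewrite mulr_gt0// ?invr_gt0 ?exprn_gt0// ltr0n bin_gt0.
Qed.

Lemma binom_mass_sym n k : (k <= n)%N -> binom_mass n (n - k) = binom_mass n k.
Proof. by move=> kn; rewrite /binom_mass bin_sub. Qed.

Lemma sum_binom_mass n : \sum_(k < n.+1) binom_mass n k = 1.
Proof.
rewrite /binom_mass -big_distrl/= -natr_sum.
rewrite (_ : (\sum_(i < n.+1) 'C(n, i))%N = 2 ^ n)%N.
  by rewrite natrX mulfV// expf_neq0.
have := expnDn 1 1 n; rewrite addn1 => ->.
by apply: eq_bigr => i _; rewrite !exp1n !muln1.
Qed.

Lemma central_bin_double m :
  ('C(m.+1.*2, m.+1) = 2 * 'C(m.*2.+1, m.+1))%N.
Proof.
rewrite doubleS binS mulSn mul1n; congr (_ + _)%N.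
by rewrite -[in RHS]bin_sub; [congr 'C(_, _); lia|lia].
Qed.

Lemma central_bin_rec m :
  (m.+1 * 'C(m.+1.*2, m.+1) = 2 * m.*2.+1 * 'C(m.*2, m))%N.
Proof.
rewrite central_bin_double mulnCA -mulnA; congr (_ * _)%N.
by have := mul_bin_diag m.*2.+1 m => /= ->.
Qed.

(** Both sides satisfy the recurrence [wallisSS] taken along even indices. *)
Lemma wallis_central m : wallis m.*2 = pi / 2 * binom_mass m.*2 m :> R.
Proof.
elim: m => [|m IH].
  by rewrite wallis0 /binom_mass bin0 expr0 invr1 !mulr1.
have m0 : m.*2.+2%:R != 0 :> R by rewrite pnatr_eq0.
apply: (mulfI m0); rewrite doubleS wallisSS IH mulrCA [RHS]mulrCA; congr (_ * _).
have := congr1 (fun n => n%:R * 2 ^- m.*2.+1 : R) (central_bin_rec m).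
rewrite /binom_mass doubleS !natrM !exprS => E.
have -> : m.*2.+2%:R = 2 * m.+1%:R :> R by rewrite -natrM mul2n doubleS.
have p0 : 2 ^+ m.*2 != 0 :> R by rewrite expf_neq0.
have -> : 2 * m.+1%:R * ('C(m.*2.+2, m.+1)%:R / (2 * (2 * 2 ^+ m.*2))) =
          m.+1%:R * 'C(m.*2.+2, m.+1)%:R / (2 * 2 ^+ m.*2) :> R by field.
by rewrite E; field.
Qed.

(** For odd [n] the central mass equals that of [n.+1], by Pascal's rule, so one
    formula covers both parities. *)
Lemma wallis_uphalf n :
  wallis (uphalf n).*2 = pi / 2 * binom_mass n (uphalf n) :> R.
Proof.
rewrite wallis_central; congr (_ * _); have := odd_double_half n.
rewrite uphalf_half; move: (odd n) (n./2) => [] h <- //.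
rewrite !add1n /binom_mass central_bin_double natrM doubleS [2 ^+ _.+2]exprS.
by field; rewrite expf_neq0.
Qed.

(** Here [uphalf n] is a mode, and the bound is [wallis_sqr_le] at the even index
    [(uphalf n).*2], which is [n] or [n.+1]. *)
Lemma binom_mass_mode_le n : n%:R * binom_mass n (uphalf n) ^+ 2 <= 2 / pi.
Proof.
have pi0 := @pi_gt0 R.
have := @wallis_sqr_le R (uphalf n).*2; rewrite wallis_uphalf.
set b := binom_mass _ _ => h.
have : n%:R * (pi / 2 * b) ^+ 2 <= pi / 2.
  apply: le_trans h; rewrite ler_wpM2r ?sqr_ge0// ler_nat.
  by rewrite -[leqLHS]odd_double_half uphalf_half; case: odd => /=; lia.
rewrite exprMn mulrCA -ler_pdivlMl ?exprn_gt0 ?divr_gt0//.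
by congr (_ <= _); field; lra.
Qed.

Lemma binom_mass_mode_ge n : 2 / pi <= n.+2%:R * binom_mass n (uphalf n) ^+ 2.
Proof.
have pi0 := @pi_gt0 R.
have := @wallis_sqr_ge R (uphalf n).*2; rewrite wallis_uphalf.
set b := binom_mass _ _ => h.
have : pi / 2 <= n.+2%:R * (pi / 2 * b) ^+ 2.
  apply: (le_trans h); rewrite ler_wpM2r ?sqr_ge0// ler_nat ltnS.
  by rewrite -[in leqRHS](odd_double_half n) uphalf_half; case: odd => /=; lia.
rewrite exprMn mulrCA -ler_pdivrMl ?exprn_gt0 ?divr_gt0//.
by congr (_ <= _); field; lra.
Qed.

Lemma binom_massS n k : (k < n)%N ->
  k.+1%:R * binom_mass n k.+1 = (n - k)%:R * binom_mass n k.
Proof. by move=> kn; rewrite /binom_mass !mulrA -!natrM mul_bin_left. Qed.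

(** This and the next lemma only use [1 + u <= expR u], applied to the relative
    increments [- 2 t / (1 + t)] and [2 t / (1 - t)] of the ratio
    [(1 - t) / (1 + t)] and of its inverse. *)
Lemma onem_le_expR (t : R) :
  0 <= t -> 1 - t <= (1 + t) * expR (- (2 * t) + 4 * t ^+ 2).
Proof.
move=> t0.
have : (1 + t) * (1 + - (2 * t) / (1 + t)) <=
       (1 + t) * expR (- (2 * t) + 4 * t ^+ 2).
  apply: ler_wpM2l; first lra.
  apply: (le_trans (expR_ge1Dx _)).
  rewrite ler_expR ler_pdivrMr; last by lra.
  have := sqr_ge0 t; have := exprn_ge0 3 t0.
  rewrite (_ : (- (2 * t) + 4 * t ^+ 2) * (1 + t) =
    - (2 * t) + 2 * t ^+ 2 + 4 * t ^+ 3); last by ring.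
  lra.
by congr (_ <= _); field; lra.
Qed.

Lemma expR_le_onem (t : R) :
  0 <= t <= 2^-1 -> (1 + t) * expR (- (2 * t) - 4 * t ^+ 2) <= 1 - t.
Proof.
move=> /andP[t0 t1].
have : (1 - t) * (1 + (2 * t) / (1 - t)) <= (1 - t) * expR (2 * t + 4 * t ^+ 2).
  apply: ler_wpM2l; first lra.
  apply: (le_trans (expR_ge1Dx _)).
  rewrite ler_expR ler_pdivrMr; last by lra.
  have := sqr_ge0 t => t2.
  have : 0 <= (1 - 2 * t) * t ^+ 2 by apply: mulr_ge0 => //; lra.
  rewrite (_ : (2 * t + 4 * t ^+ 2) * (1 - t) =
    2 * t + 2 * ((1 - 2 * t) * t ^+ 2)); last by ring.
  lra.
rewrite (_ : (1 - t) * (1 + (2 * t) / (1 - t)) = 1 + t); last by field; lra.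
by move=> h; rewrite -opprD expRN -ler_pdivlMr ?invr_gt0 ?expR_gt0// invrK.
Qed.

(** The point [t] is the standardised midpoint of [k] and [k.+1]; measured on the
    scale [n + 1] rather than [n], it makes the ratio of masses symmetric. *)
Lemma binom_mass_ratio n k (t := (2 * k%:R + 1 - n%:R) / (n%:R + 1) : R) :
  (k < n)%N -> (1 + t) * binom_mass n k.+1 = (1 - t) * binom_mass n k.
Proof.
move=> kn; have n1 : n%:R + 1 != 0 :> R by rewrite natr1 pnatr_eq0.
have -> : 1 + t = 2 / (n%:R + 1) * k.+1%:R by rewrite /t -natr1; field.
have -> : 1 - t = 2 / (n%:R + 1) * (n - k)%:R.
  by rewrite /t natrB 1?ltnW//; field.
by rewrite -!mulrA binom_massS.
Qed.

Lemma binom_mass_step n k (t := (2 * k%:R + 1 - n%:R) / (n%:R + 1) : R) :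
  (k < n)%N -> 0 <= t <= 2^-1 ->
  binom_mass n k * expR (- (2 * t) - 4 * t ^+ 2) <= binom_mass n k.+1 <=
  binom_mass n k * expR (- (2 * t) + 4 * t ^+ 2).
Proof.
move=> kn t01; have /andP[t0 _] := t01.
have t1 : 0 < 1 + t by lra.
have a0 := ltW (binom_mass_gt0 (ltnW kn)).
have r : (1 + t) * binom_mass n k.+1 = binom_mass n k * (1 - t).
  by rewrite (binom_mass_ratio kn) mulrC.
apply/andP; split; rewrite -(ler_pM2l t1) r mulrCA; apply: ler_wpM2l => //.
  exact: expR_le_onem.
exact: onem_le_expR.
Qed.

(** Iterating [binom_mass_step] from the mode: the increment of [g] between
    consecutive integers is exactly [2 t], and [tau] bounds every [t] met on the
    way. *)
Lemma binom_mass_iter n j (c := uphalf n) (v := fun i : nat => i%:R - n%:R / 2 : R)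
    (g := fun i : nat => 2 * (v i ^+ 2 - v c ^+ 2) / (n%:R + 1) : R) (tau : R) :
  (c + j <= n)%N -> 2 * v (c + j)%N / (n%:R + 1) <= tau -> tau <= 2^-1 ->
  binom_mass n c * expR (- g (c + j)%N - 4 * j%:R * tau ^+ 2) <=
  binom_mass n (c + j) <=
  binom_mass n c * expR (- g (c + j)%N + 4 * j%:R * tau ^+ 2).
Proof.
have n1 : 0 < n%:R + 1 :> R by rewrite natr1 ltr0n.
have cn : n%:R <= 2 * c%:R :> R.
  rewrite -natrM ler_nat -[leqLHS]odd_double_half /c uphalf_half.
  by case: odd => /=; lia.
elim: j => [|j IH] cjn vtau tau2.
  rewrite addn0 /g subrr mulr0 mul0r oppr0 mulr0 mul0r subr0 addr0 expR0 mulr1.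
  by rewrite lexx.
rewrite addnS in cjn vtau *.
set k := (c + j)%N in IH cjn vtau *.
pose t : R := (2 * k%:R + 1 - n%:R) / (n%:R + 1).
have ck : c%:R <= k%:R :> R by rewrite ler_nat /k leq_addr.
have t0 : 0 <= t by rewrite divr_ge0//; lra.
have tt : t <= tau.
  apply: le_trans vtau; rewrite /t ler_pM2r ?invr_gt0// /v -[k.+1%:R]natr1; lra.
have t2 : t ^+ 2 <= tau ^+ 2 by apply: lerXn2r; rewrite ?nnegrE// (le_trans t0 tt).
have gS : g k.+1 = g k + 2 * t.
  by rewrite /g /t /v -[k.+1%:R]natr1; field; lra.
have [IHl IHu] : binom_mass n c * expR (- g k - 4 * j%:R * tau ^+ 2) <=
    binom_mass n k /\
  binom_mass n k <= binom_mass n c * expR (- g k + 4 * j%:R * tau ^+ 2).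
  apply/andP/IH => //; first exact: ltnW.
  apply: le_trans vtau; rewrite ler_pM2r ?invr_gt0// /v -[k.+1%:R]natr1; lra.
have /andP[l u] :
  binom_mass n k * expR (- (2 * t) - 4 * t ^+ 2) <= binom_mass n k.+1 <=
  binom_mass n k * expR (- (2 * t) + 4 * t ^+ 2).
  by apply: binom_mass_step => //; rewrite t0 (le_trans tt).
have c0 : 0 < binom_mass n c.
  exact/binom_mass_gt0/(leq_trans (leq_addr j c))/ltnW.
apply/andP; split.
  have := ler_wpM2r (expR_ge0 (- (2 * t) - 4 * t ^+ 2)) IHl.
  rewrite /= -[leLHS]mulrA -expRD => /le_trans/(_ l); apply: le_trans.
  by rewrite ler_pM2l// ler_expR gS -[j.+1%:R]natr1; lra.
have := ler_wpM2r (expR_ge0 (- (2 * t) + 4 * t ^+ 2)) IHu.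
rewrite /= -[leRHS]mulrA -expRD => /(le_trans u)/le_trans; apply.
by rewrite ler_pM2l// ler_expR gS -[j.+1%:R]natr1; lra.
Qed.

End BinomialMass.

(** * The local limit estimate *)

Section LocalLimitEstimates.
Context {R : realType}.

(** Error budget for the exponents.  The variable [G] is the exponent given by
    [binom_mass_iter] at standardised position [Y] after [j] steps, [w] is the
    squared distance of the mode to [n / 2] with [n = s ^+ 2], and the term
    [(s ^+ 2)^-1] of the lower bound is the price of [binom_mass_mode_bounds].
    Every discrepancy with [y ^+ 2 / 2] is a multiple of [x ^+ 3 / s], [x / s] or
    [1 / s], and [x <= x ^+ 3 + 1]. *)
Lemma local_limit_exponent (s x y Y w j : R)
    (G := 2 * ((s * Y / 2) ^+ 2 - w) / (s ^+ 2 + 1)) (tau := s * Y / (s ^+ 2 + 1))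
    (E := (4 * x ^+ 3 + 4) / s) :
  1 <= s -> 0 <= Y <= x -> x <= s / 2 -> `|y - Y| <= s^-1 -> 0 <= w <= 4^-1 ->
  0 <= j <= s * Y / 2 ->
  - G + 4 * j * tau ^+ 2 <= E - y ^+ 2 / 2 /\
  - E - y ^+ 2 / 2 <= - (s ^+ 2)^-1 - G - 4 * j * tau ^+ 2.
Proof.
move=> s1 /andP[Y0 Yx] xs yY /andP[w0 w4] /andP[j0 jY].
have s0 : 0 < s by lra.
have N0 : 0 < s ^+ 2 + 1 by rewrite ltr_wpDl ?sqr_ge0.
pose i := s^-1; have i0 : 0 < i by rewrite invr_gt0.
have si : s * i = 1 by rewrite mulfV// gt_eqF.
have i1 : i <= 1 by rewrite invf_le1.
have x0 : 0 <= x by lra.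
have iN : (s ^+ 2 + 1)^-1 <= i ^+ 2.
  by rewrite /i exprVn lef_pV2 ?posrE ?exprn_gt0//; lra.
have N0' : 0 < (s ^+ 2 + 1)^-1 by rewrite invr_gt0.
have -> : G = Y ^+ 2 / 2 - 2^-1 * (Y ^+ 2 / (s ^+ 2 + 1))
              - 2 * w / (s ^+ 2 + 1).
  by rewrite /G; field; lra.
(* drift of the variance from n to n + 1 *)
have A : 0 <= Y ^+ 2 / (s ^+ 2 + 1) <= x * i / 2.
  rewrite divr_ge0 ?sqr_ge0 ?(ltW N0)//=.
  have <- : x * (s / 2) * i ^+ 2 = x * i / 2.
    by transitivity (x * i / 2 * (s * i)); [field|rewrite si mulr1].
  apply: ler_pM; rewrite ?sqr_ge0 ?(ltW N0')// expr2.
  by apply: ler_pM; lra.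
(* recentring at the mode *)
have B : 0 <= w / (s ^+ 2 + 1) <= i / 4.
  rewrite divr_ge0 ?(ltW N0)//=.
  apply: (@le_trans _ _ (4^-1 * i ^+ 2)).
    by apply: ler_pM => //; exact: ltW.
  by rewrite expr2; nra.
(* accumulated error of the steps *)
have C : 0 <= j * tau ^+ 2 <= x ^+ 3 * i / 2.
  rewrite mulr_ge0 ?sqr_ge0//=.
  have tau0 : 0 <= tau by rewrite divr_ge0 ?(ltW N0)// mulr_ge0// ltW.
  have tauY : tau <= Y * i.
    have <- : s * Y * i ^+ 2 = Y * i.
      by transitivity (Y * i * (s * i)); [ring|rewrite si mulr1].
    by rewrite /tau ler_wpM2l// mulr_ge0// ltW.
  apply: (@le_trans _ _ (s * Y / 2 * (Y * i) ^+ 2)).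
    apply: ler_pM; rewrite ?sqr_ge0//.
    by apply: lerXn2r; rewrite ?nnegrE// mulr_ge0// ltW.
  have -> : s * Y / 2 * (Y * i) ^+ 2 = Y ^+ 3 * i / 2.
    by transitivity (Y ^+ 3 * i / 2 * (s * i)); [field|rewrite si mulr1].
  rewrite ler_pM2r// ler_pM2r//.
  by apply: lerXn2r; rewrite ?nnegrE.
(* moving within a cell *)
have D : `|y ^+ 2 - Y ^+ 2| <= i * (2 * x + 1).
  rewrite subr_sqr normrM; apply: ler_pM => //.
  move: yY; rewrite -/i => yY.
  rewrite ler_norml; move: yY; rewrite ler_norml => /andP[yY1 yY2].
  by apply/andP; split; lra.
have X : x * i <= x ^+ 3 * i + i.
  rewrite -[X in _ + X]mul1r -mulrDl ler_wpM2r ?(ltW i0)//.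
  have := exprn_ge0 3 x0; have [x1|x1] := leP x 1; first lra.
  have : x <= x ^+ 3 by rewrite ler_eXnr// ltW.
  by lra.
have -> : (s ^+ 2)^-1 = i ^+ 2 by rewrite /i exprVn.
have i2 : i ^+ 2 <= i by rewrite expr2; nra.
have -> : E = 4 * (x ^+ 3 * i) + 4 * i by rewrite /E -/i; ring.
have x3 : 0 <= x ^+ 3 * i by rewrite mulr_ge0 ?exprn_ge0// ltW.
move: D; rewrite (_ : i * (2 * x + 1) = 2 * (x * i) + i); last by ring.
rewrite ler_norml => /andP[D1 D2].
move: A B C => /andP[A1 A2] /andP[B1 B2] /andP[C1 C2].
have -> : 2 * w / (s ^+ 2 + 1) = 2 * (w / (s ^+ 2 + 1)) by ring.
have -> : 4 * j * tau ^+ 2 = 4 * (j * tau ^+ 2) by ring.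
split; lra.
Qed.


(** The factor comes from [n + 2 <= n * expR (2 / n)]. *)
Lemma binom_mass_mode_bounds n
    (K := 2 / Num.sqrt n%:R / Num.sqrt (2 * pi) : R) :
  (0 < n)%N ->
  binom_mass n (uphalf n) <= K /\ K <= binom_mass n (uphalf n) * expR (n%:R^-1).
Proof.
move=> n0; have n0' : 0 < n%:R :> R by rewrite ltr0n.
have pi0 := @pi_gt0 R.
have K0 : 0 <= K by rewrite !divr_ge0 ?sqrtr_ge0.
have K2 : K ^+ 2 = 2 / pi / n%:R.
  rewrite /K !exprMn !exprVn !sqr_sqrtr; [|lra..].
  by field; lra.
have b0 : 0 <= binom_mass n (uphalf n) :> R.
  by apply/ltW/binom_mass_gt0; lia.
split.
  rewrite -ler_sqr ?nnegrE// K2 ler_pdivlMr// mulrC; exact: binom_mass_mode_le.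
rewrite -ler_sqr ?nnegrE ?mulr_ge0 ?expR_ge0// K2 exprMn -expRM_natr.
rewrite ler_pdivrMr//; apply: (le_trans (binom_mass_mode_ge n)).
rewrite [leLHS]mulrC -[leRHS]mulrA. apply: ler_wpM2l; first exact: sqr_ge0.
rewrite -ler_pdivrMr//; apply: le_trans (expR_ge1Dx _).
by rewrite -addn2 natrD mulrDl mulfV ?gt_eqF// mulrC.
Qed.

End LocalLimitEstimates.

Section LocalLimit.
Context {R : realType}.

Lemma binom_mass_local_limit_right n k (x y : R) (s := Num.sqrt n%:R)
    (Y := (2 * k%:R - n%:R) / s) (E := (4 * x ^+ 3 + 4) / s) :
  (0 < n)%N -> (k <= n)%N -> 0 <= Y <= x -> x <= s / 2 -> `|y - Y| <= s^-1 ->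
  expR (- E) * (2 / s * std_normal_pdf y) <= binom_mass n k <=
  expR E * (2 / s * std_normal_pdf y).
Proof.
move=> n0 kn Yx xs yY.
have s2 : s ^+ 2 = n%:R by rewrite sqr_sqrtr.
have s1 : 1 <= s.
  by rewrite -(@ler_pXn2r _ 2) ?nnegrE ?sqrtr_ge0// s2 expr1n ler1n.
have s0 : 0 < s by lra.
have sY : s * Y = 2 * k%:R - n%:R by rewrite /Y; field; lra.
have /andP[Y0 _] := Yx.
have sY0 : 0 <= s * Y by rewrite mulr_ge0// ltW.
pose c := uphalf n.
have nc : n%:R <= 2 * c%:R :> R by rewrite -natrM ler_nat /c; lia.
have cn : 2 * c%:R <= n%:R + 1 :> R by rewrite natr1 -natrM ler_nat /c; lia.
have nk : (n <= 2 * k)%N by rewrite -(ler_nat R) natrM; lra.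
have ck : (c <= k)%N by rewrite /c; lia.
have w01 : 0 <= (c%:R - n%:R / 2 : R) ^+ 2 <= 4^-1.
  rewrite sqr_ge0/= (_ : 4^-1 = 2^-1 ^+ 2); last by field.
  by apply: lerXn2r; rewrite ?nnegrE; lra.
have jY : 0 <= ((k - c)%:R : R) <= s * Y / 2 by rewrite ler0n/= natrB// sY; lra.
have [up low] := local_limit_exponent s1 Yx xs yY w01 jY.
have tau2 : s * Y / (n%:R + 1) <= 2^-1.
  rewrite ler_pdivrMr; last by rewrite natr1 ltr0n.
  have : s * Y <= s * (s / 2) by rewrite ler_wpM2l ?(ltW s0)//; lra.
  by rewrite mulrA -expr2 s2; lra.
have vtau :
    2 * ((c + (k - c))%N%:R - n%:R / 2) / (n%:R + 1) <= s * Y / (n%:R + 1).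
  rewrite subnKC// sY le_eqVlt; apply/orP; left; apply/eqP.
  by congr (_ / _); field.
have := binom_mass_iter _ vtau tau2; rewrite -/c subnKC// => /(_ kn).
have -> : k%:R - n%:R / 2 = s * Y / 2 by rewrite sY; field.
rewrite s2 in up low => /andP[iterl iteru].
have [model modeu] := @binom_mass_mode_bounds R n n0.
have phi0 a : 2 / s * std_normal_pdf y * expR a =
    2 / s / Num.sqrt (2 * pi) * expR (a - y ^+ 2 / 2).
  rewrite /std_normal_pdf expRD mulNr; ring.
have c0 : 0 < (binom_mass n c : R) by exact/binom_mass_gt0/(leq_trans ck kn).
apply/andP; split; rewrite mulrC phi0.
  apply: le_trans iterl.
  apply: (@le_trans _ _
    (binom_mass n c * expR n%:R^-1 * expR (- E - y ^+ 2 / 2))).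
    by rewrite ler_wpM2r ?expR_ge0.
  rewrite -[leLHS]mulrA ler_pM2l// -expRD ler_expR.
  move: low; rewrite -/E; set a := 2 * _ / _; set b := 4 * _ * _ ^+ 2.
  by move: (E) a b => e a b; lra.
apply: (le_trans iteru); apply: ler_pM; rewrite ?expR_ge0 ?(ltW c0)//.
by rewrite ler_expR.
Qed.

(** The left half follows from the right half by the symmetry [k -> n - k]. *)
Lemma binom_mass_local_limit n k (x y : R) (s := Num.sqrt n%:R)
    (Y := (2 * k%:R - n%:R) / s) (E := (4 * x ^+ 3 + 4) / s) :
  (0 < n)%N -> (k <= n)%N -> `|Y| <= x -> x <= s / 2 -> `|y - Y| <= s^-1 ->
  expR (- E) * (2 / s * std_normal_pdf y) <= binom_mass n k <=
  expR E * (2 / s * std_normal_pdf y).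
Proof.
move=> n0 kn Yx xs yY; have [Y0|Y0] := leP 0 Y.
  apply: binom_mass_local_limit_right => //.
  by apply/andP; split => //; exact: le_trans (ler_norm Y) Yx.
rewrite -binom_mass_sym//.
rewrite (_ : std_normal_pdf y = std_normal_pdf (- y)); last first.
  by rewrite /std_normal_pdf sqrrN.
have Yn : (2 * (n - k)%:R - n%:R) / s = - Y by rewrite natrB// /Y; ring.
apply: binom_mass_local_limit_right => //; rewrite ?leq_subr// -/s Yn.
  by rewrite -(ltr0_norm Y0) normr_ge0.
by rewrite opprK addrC distrC.
Qed.

(** The local limit estimate bounds the density on the whole cell of radius
    [s^-1] and length [2 / s] around [Y], hence the probability of the cell. *)
Lemma binom_mass_cell n k (x : R) (s := Num.sqrt n%:R)
    (Y := (2 * k%:R - n%:R) / s) (E := (4 * x ^+ 3 + 4) / s)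
    (D := std_normal_cdf (Y + s^-1) - std_normal_cdf (Y - s^-1)) :
  (0 < n)%N -> (k <= n)%N -> `|Y| <= x -> x <= s / 2 ->
  expR (- E) * D <= binom_mass n k <= expR E * D.
Proof.
move=> n0 kn Yx xs.
have s0 : 0 < s by rewrite sqrtr_gt0 ltr0n.
have i0 : 0 < s^-1 by rewrite invr_gt0.
have ll y : Y - s^-1 <= y <= Y + s^-1 ->
    expR (- E) * (2 / s * std_normal_pdf y) <= binom_mass n k <=
    expR E * (2 / s * std_normal_pdf y).
  move=> /andP[y1 y2]; apply: (binom_mass_local_limit n0 kn Yx xs).
  by rewrite ler_distl; apply/andP; split.
have le : Y - s^-1 <= Y + s^-1 by rewrite lerD2l; lra.
have len : Y + s^-1 - (Y - s^-1) = 2 / s by ring.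
have cE : expR E * expR (- E) = 1 by rewrite -expRD subrr expR0.
have cE' : expR (- E) * expR E = 1 by rewrite mulrC.
have E0 := expR_gt0 E; have E1 := expR_gt0 (- E).
have s20 : 0 < 2 / s by rewrite divr_gt0.
apply/andP; split.
  have := @std_normal_cdfB_le _ _ _ (expR E * binom_mass n k / (2 / s)) le _.
  rewrite len divfK ?gt_eqF// => h.
  rewrite -(ler_pM2l E0) mulrA cE mul1r; apply: h => y /ll/andP[h _].
  by rewrite ler_pdivlMr// mulrC -(ler_pM2l E1) [leRHS]mulrA cE' mul1r.
have := @std_normal_cdfB_ge _ _ _ (expR (- E) * binom_mass n k / (2 / s)) le _.
rewrite len divfK ?gt_eqF// => h.
rewrite -(ler_pM2l E1) [leRHS]mulrA cE' mul1r; apply: h => y /ll/andP[_ h].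
by rewrite ler_pdivrMr// [leRHS]mulrC -(ler_pM2l E0) mulrA cE mul1r.
Qed.

End LocalLimit.

(** * The law of the random variable *)

Section SymmetricBinomialLaw.
Context {R : realType} d (T : measurableType d) (P : probability T R).

Lemma symmetric_binomial_le n (S : {RV P >-> R}) (B : set R) (Q : pred 'I_n.+1) :
  symmetric_binomial n S -> measurable B ->
  (forall k : 'I_n.+1, Q k -> B k%:R) ->
  ((\sum_(k < n.+1 | Q k) binom_mass n k)%:E <= P (S @^-1` B))%E.
Proof.
move=> hS mB QB; pose F (k : 'I_n.+1) := S @^-1` [set k%:R].
have mF k : measurable (F k).
  exact: measurable_funPTI.
have tF : trivIset setT F.
  move=> i j _ _ [w []]; rewrite /F/= => -> /eqP.
  by rewrite eqr_nat => /eqP ij; exact/val_inj.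
rewrite -sumEFin (eq_bigr (P \o F)); last first.
  by move=> k _; rewrite /= hS// -ltnS.
rewrite /= -measure_bigsetU_ord//; apply: le_measure.
- by rewrite inE; apply: bigsetU_measurable.
- by rewrite inE; exact: measurable_funPTI.
- elim/big_ind : _ => [//|X Y XB YB|k Qk w]; first by rewrite subUset.
  by rewrite /F/= => ->; exact: QB.
Qed.

(** Since the masses sum to 1, the lower bound [symmetric_binomial_le] for [B] and
    for its complement leaves no slack. *)
Lemma symmetric_binomial_preimage n (S : {RV P >-> R}) (B : set R)
    (Q : pred 'I_n.+1) :
  symmetric_binomial n S -> measurable B ->
  (forall k : 'I_n.+1, reflect (B k%:R) (Q k)) ->
  fine (P (S @^-1` B)) = \sum_(k < n.+1 | Q k) binom_mass n k.
Proof.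
move=> hS mB QB.
have mSB : measurable (S @^-1` B).
  exact: measurable_funPTI.
have lo := symmetric_binomial_le hS mB (fun k => elimT (QB k)).
have := @symmetric_binomial_le _ S (~` B) (predC Q) hS (measurableC mB).
move=> /(_ (fun k => elimN (QB k))); rewrite preimage_setC probability_setC//.
move: lo; have := sum_binom_mass (R := R) n; rewrite (bigID Q)/=.
rewrite -(fineK (fin_num_measure P _ mSB)) -EFinB !lee_fin.
move: (fine _) => p tot lo hi.
have {}hi : \sum_(k < n.+1 | ~~ Q k) binom_mass n k <= 1 - p by [].
by rewrite /=; apply/eqP; rewrite eq_le; apply/andP; split; lra.
Qed.

End SymmetricBinomialLaw.

(** * From the window to the interval *)

Section CountingWindow.
Context {R : realType}.

(** The last two clauses locate the outer edges [a - 1 / 2] and [b - 1 / 2] of the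
    union of the unit cells centred at these integers: they are within [1 / 2] of
    the ends of the open interval of radius [L] around [n / 2].  The window may
    be empty ([a = b]). *)
Lemma integer_window n (L : R) : 0 < L -> L <= n%:R / 2 ->
  exists a b : nat, [/\ (a <= b <= n.+1)%N,
    forall k, (k <= n)%N -> (`|k%:R - n%:R / 2| < L) = (a <= k < b)%N,
    `|2 * a%:R - 1 - n%:R + 2 * L| <= 1 &
    `|2 * b%:R - 1 - n%:R - 2 * L| <= 1].
Proof.
move=> L0 Ln; have /truncn_itv : 0 <= n%:R / 2 - L by lra.
set z := Num.trunc _ => /andP[z1 z2].
have zn : (2 * z < n)%N by rewrite -(ltr_nat R) natrM; lra.
have bE : (n - z)%:R = n%:R - z%:R :> R by rewrite natrB//; lia.
rewrite -[z.+1%:R]natr1 in z2.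
exists z.+1, (n - z)%N; split.
- by apply/andP; split; lia.
- move=> k kn; rewrite ltr_norml; apply/andP/andP => -[k1 k2]; split.
  + by rewrite -(ltr_nat R); lra.
  + by rewrite -(ltr_nat R) bE; lra.
  + by move: k1; rewrite -(ler_nat R) -[z.+1%:R]natr1; lra.
  + by move: k2; rewrite -(ler_nat R) -[k.+1%:R]natr1 bE; lra.
- by rewrite ler_norml -[z.+1%:R]natr1; apply/andP; split; lra.
- by rewrite ler_norml bE; apply/andP; split; lra.
Qed.

End CountingWindow.

(** A relative error [expR e1] and an absolute error [e2] combine into [e1 + e2]
    because [q] is a probability and [1 + e2 <= expR e2]. *)
Lemma expR_approx {R : realType} (p q r e1 e2 : R) :
  0 <= q <= 1 -> 0 <= e1 -> 0 <= e2 -> `|r - q| <= e2 ->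
  expR (- e1) * r <= p <= expR e1 * r ->
  `|p - q| <= expR (e1 + e2) - 1.
Proof.
move=> /andP[q0 q1] e10 e20; rewrite ler_norml => /andP[r1 r2] /andP[p1 p2].
have E1 := expR_ge1Dx e1; have E2 := expR_ge1Dx e2.
have N1 : 1 - e1 <= expR (- e1) by exact: expR_ge1Dx.
have N0 := expR_ge0 (- e1).
have E12 : expR e1 * (1 + e2) <= expR (e1 + e2).
  by rewrite expRD ler_wpM2l ?expR_ge0.
have E3 := expR_ge1Dx (e1 + e2).
have N2 : expR (- e1) <= 1 by rewrite -[leRHS]expR0 ler_expR; lra.
rewrite ler_norml; apply/andP; split.
- have : expR (- e1) * (q - e2) <= expR (- e1) * r by rewrite ler_wpM2l//; lra.
  have : 0 <= (1 - expR (- e1)) * (1 - q) by rewrite mulr_ge0//; lra.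
  have : 0 <= (1 - expR (- e1)) * e2 by rewrite mulr_ge0//; lra.
  nra.
- have : expR e1 * r <= expR e1 * (q + e2) by rewrite ler_wpM2l ?expR_ge0//; lra.
  have : 0 <= (expR e1 - 1) * (1 - q) by rewrite mulr_ge0//; lra.
  nra.
Qed.

(** * The normal approximation *)

Theorem mainTheorem1 (R : realType) (d : measure_display)
    (T : measurableType d) (P : probability T R) (n : nat) (S : {RV P >-> R})
    (hS : symmetric_binomial n S) (x : R) (hx : 0 < x)
    (hn : Num.max (4 * x ^+ 2) 2 <= n%:R) :
  `| fine (P [set w | `|S w - n%:R / 2| < x * (Num.sqrt n%:R / 2)])
     - \int[lebesgue_measure]_(s in `[- x, x])
         (expR (- (s ^+ 2) / 2) / Num.sqrt (2 * pi)) |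
  <= expR ((4 * x ^+ 3 + 8) / Num.sqrt n%:R) - 1.
Proof.
move: hn; rewrite ge_max => /andP[xn n2].
have n0 : (0 < n)%N by rewrite -(ltr_nat R); lra.
set s := Num.sqrt n%:R.
have ss : s ^+ 2 = n%:R by rewrite sqr_sqrtr.
have s0 : 0 < s by rewrite sqrtr_gt0 ltr0n.
have xs : x <= s / 2.
  rewrite -(@ler_pXn2r _ 2) ?nnegrE ?divr_ge0 ?(ltW hx) ?(ltW s0)//.
  by rewrite expr_div_n ss; lra.
set L := x * (s / 2).
have L0 : 0 < L by rewrite mulr_gt0// divr_gt0.
have Ln : L <= n%:R / 2.
  have : L <= (s / 2) * (s / 2) by rewrite ler_wpM2r// divr_ge0// ltW.
  by rewrite -expr2 expr_div_n ss; lra.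
have [a [b [/andP[ab bn] win aL bL]]] := integer_window L0 Ln.
pose I := `]n%:R / 2 - L, n%:R / 2 + L[%classic : set R.
have -> : [set w | `|S w - n%:R / 2| < L] = S @^-1` I.
  by apply/seteqP; split=> w /=; rewrite /I/= in_itv/= ltr_distl.
have QI (k : 'I_n.+1) : reflect (I k%:R) (a <= k < b)%N.
  have kn : (k <= n)%N by rewrite -ltnS.
  rewrite -(win _ kn) ltr_distl.
  have -> : I k%:R = (k%:R \in `]n%:R / 2 - L, n%:R / 2 + L[ : Prop) by [].
  by rewrite in_itv/=; exact: idP.
have mI : measurable I by exact: measurable_itv.
rewrite (symmetric_binomial_preimage hS mI QI).
have -> : \sum_(k < n.+1 | (a <= k < b)%N) binom_mass n k =
          \sum_(a <= k < b) binom_mass n k :> R.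
  rewrite (big_nat_widen _ _ n.+1)// (big_nat_widenl _ 0)//= big_mkord.
  by apply: eq_bigl => k; rewrite andbC.
rewrite -std_normal_cdfB; last by lra.
(* the normal distribution function at the common edge of two cells *)
pose f k : R := std_normal_cdf ((2 * k%:R - 1 - n%:R) / s).
set E := (4 * x ^+ 3 + 4) / s.
have E0 : 0 <= E by rewrite divr_ge0 ?(ltW s0)// addr_ge0// mulr_ge0// exprn_ge0// ltW.
have i0 : 0 < s^-1 by rewrite invr_gt0.
apply: (@le_trans _ _ (expR (E + s^-1) - 1)); last first.
  rewrite lerD2r ler_expR /E -[X in _ + X]mul1r -mulrDl ler_pM2r//; lra.
have cells k : (a <= k < b)%N ->
    expR (- E) * (f k.+1 - f k) <= binom_mass n k <= expR E * (f k.+1 - f k).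
  move=> akb; have kn : (k <= n)%N.
    by rewrite -ltnS; case/andP: akb => _ /leq_trans; exact.
  have Yx : `|(2 * k%:R - n%:R) / s| <= x.
    have -> : (2 * k%:R - n%:R) / s = (k%:R - n%:R / 2) * (2 / s) by field; lra.
    rewrite normrM [X in _ * X]ger0_norm ?divr_ge0 ?(ltW s0)//.
    rewrite -ler_pdivlMr ?divr_gt0// invf_div; apply: ltW.
    by rewrite win.
  have := binom_mass_cell n0 kn Yx xs; rewrite -/s -/E.
  have -> : (2 * k%:R - n%:R) / s + s^-1 = (2 * k.+1%:R - 1 - n%:R) / s.
    by rewrite -[k.+1%:R]natr1; field; lra.
  have -> : (2 * k%:R - n%:R) / s - s^-1 = (2 * k%:R - 1 - n%:R) / s.
    by field; lra.
  exact.
have fE := telescope_sumr f ab.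
apply: (@expR_approx _ _ _ (f b - f a)) => //.
- apply/andP; split; last by apply: std_normal_cdfB_le1; lra.
  rewrite std_normal_cdfB ?Rintegral_ge0//; last by lra.
  by move=> t _; rewrite divr_ge0 ?expR_ge0 ?sqrtr_ge0.
- exact: ltW.
- have edge u v : `|u - 2 * v| <= 1 ->
      `|std_normal_cdf (u / s) - std_normal_cdf (v * 2 / s)| <= s^-1 / 2.
    move=> uv; apply: (le_trans (std_normal_cdf_lipschitz _ _)).
    rewrite ler_pM2r// -mulrBl normrM (ger0_norm (ltW i0)) -[leRHS]mul1r ler_pM2r//.
    by rewrite [v * 2]mulrC.
  have xE : x = L * 2 / s by rewrite /L; field; lra.
  have := edge _ _ bL; have := edge (2 * a%:R - 1 - n%:R) (- L).
  rewrite mulrN opprK => /(_ aL); rewrite mulNr mulNr -xE -/(f a) -/(f b).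
  rewrite !ler_norml => /andP[? ?] /andP[? ?]; apply/andP; split; lra.
- rewrite -fE !mulr_sumr !big_nat; apply/andP; split; apply: ler_sum => k akb.
    by have /andP[] := cells k akb.
  by have /andP[] := cells k akb.
Qed.
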